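(* For every $n\ge 3$, the hypercube graph $Q_n$ satisfies $\operatorname{nim}(\mathrm{TER}(Q_n))=0$.
   Context: $Q_n$ is the graph whose vertices are the binary strings of length $n$, two of them being adjacent exactly when they differ in a single digit. For a graph $G$ with vertex set $V$, a set $K\subseteq V$ is convex if it contains every vertex lying on any shortest path between two elements of $K$. The convex hull $[P]$ of $P\subseteq V$ is the smallest convex set containing $P$. The game $\mathrm{TER}(G)$: positions are the sets $P\subseteq V$ reachable from the starting position $\emptyset$ by the following moves. If $[V\setminus P]=V$, then the options of $P$ are all sets $P\cup\{v\}$ with $v\in V\setminus P$; if $[V\setminus P]\neq V$, then $P$ is terminal (has no options). The nim-value of a position is defined recursively by $\operatorname{nim}(p)=\operatorname{mex}\{\operatorname{nim}(q): q\text{ an option of }p\}$, where $\operatorname{mex}(A)$ is the smallest nonnegative integer not in $A$; the nim-value of a game is that of its starting position. *)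

(* Defs.v *)
From mathcomp Require Import all_boot.
Set Implicit Arguments.
Unset Strict Implicit.
Unset Printing Implicit Defensive.

(* A graph is given by its adjacency relation e : rel V on a finType V.       *)

Section Convexity.

Variables (V : finType) (e : rel V).

(* As in path.v, the vertices of a walk from x are those of x :: p. *)
Definition walk (x y : V) (p : seq V) : bool := path e x p && (last x p == y).

Definition shortest_path (x y : V) (p : seq V) : bool :=
  walk x y p && [forall m : 'I_(size p), forall q : m.-tuple V, ~~ walk x y q].

(* A shortest path has no repeated vertex, so bounding the length by #|V|     *)
(* loses nothing: see convexP.                                                *)
Definition convex (K : {set V}) : bool :=
  [forall x in K, forall y in K, forall m : 'I_#|V|, forall p : m.-tuple V,
    shortest_path x y p ==> all (mem K) (x :: p)].

Definition hull (P : {set V}) : {set V} :=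
  \bigcap_(K : {set V} | convex K && (P \subset K)) K.

Lemma shortest_pathP x y p :
  reflect (walk x y p /\ forall q, walk x y q -> size p <= size q)
          (shortest_path x y p).
Proof.
apply: (iffP andP) => -[wp minp]; split=> //.
  move=> q wq; rewrite leqNgt; apply/negP=> ltqp.
  by have /forallP/(_ (in_tuple q)) := forallP minp (Ordinal ltqp); rewrite wq.
apply/forallP=> m; apply/forallP=> q; apply/negP=> /minp.
by rewrite size_tuple leqNgt ltn_ord.
Qed.

Lemma convexP (K : {set V}) :
  reflect (forall x y p z, x \in K -> y \in K -> shortest_path x y p ->
             z \in x :: p -> z \in K)
          (convex K).
Proof.
apply: (iffP idP) => [cK x y p z xK yK sp zp | cK].
  have [/andP[ep /eqP lp] minp] := shortest_pathP _ _ _ sp.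
  have ltp : size p < #|V|.
    case: (shortenP ep) lp => q eq uq _ lq.
    have /minp le_pq : walk x y q by rewrite /walk eq lq eqxx.
    apply: leq_ltn_trans le_pq _.
    by rewrite -[(size q).+1]/(size (x :: q)) -(card_uniqP uq) max_card.
  move/forall_inP: cK => /(_ x xK)/forall_inP/(_ y yK)/forallP/(_ (Ordinal ltp)).
  by move/forallP/(_ (in_tuple p))/implyP/(_ sp)/allP/(_ z zp).
apply/forall_inP=> x xK; apply/forall_inP=> y yK; apply/forallP=> m.
apply/forallP=> p; apply/implyP=> sp; apply/allP=> z zp.
exact: cK sp zp.
Qed.

Lemma sub_hull (P : {set V}) : P \subset hull P.
Proof. by apply/bigcapsP=> K /andP[]. Qed.

Lemma hull_min (P K : {set V}) : convex K -> P \subset K -> hull P \subset K.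
Proof. by move=> cK PK; apply: bigcap_inf; rewrite cK. Qed.

Lemma convex_hull (P : {set V}) : convex (hull P).
Proof.
apply/convexP=> x y p z xH yH sp zp; apply/bigcapP=> K cPK.
have /andP[/convexP cK _] := cPK.
by apply: cK sp zp; [move/bigcapP: xH; apply | move/bigcapP: yH; apply].
Qed.

End Convexity.

Lemma mex_exists (s : seq nat) : exists n, n \notin s.
Proof.
exists (\max_(i <- s) i).+1; apply/negP=> sm.
by have := @leq_bigmax_seq _ s xpredT id _ sm isT; rewrite ltnn.
Qed.

Definition mex (s : seq nat) : nat := ex_minn (mex_exists s).

Section TER.

Variables (V : finType) (e : rel V).

Definition ter_options (P : {set V}) : {set {set V}} :=
  if hull e (~: P) == [set: V] then [set v |: P | v in ~: P] else set0.

(* Every move enlarges P, so #|~: P|.+1 units of fuel are enough: see         *)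
(* ter_nimE.                                                                  *)
Fixpoint ter_nim_rec (k : nat) (P : {set V}) : nat :=
  if k is k'.+1 then mex [seq ter_nim_rec k' Q | Q <- enum (ter_options P)]
  else 0.

Definition ter_nim (P : {set V}) : nat := ter_nim_rec #|~: P|.+1 P.

Lemma ter_options_card P Q : Q \in ter_options P -> #|~: Q| < #|~: P|.
Proof.
rewrite /ter_options; case: ifP => _; last by rewrite inE.
case/imsetP=> v vP ->; apply: proper_card; rewrite setCU setIC -setDE.
exact: properD1.
Qed.

Lemma ter_nimE P : ter_nim P = mex [seq ter_nim Q | Q <- enum (ter_options P)].
Proof.
have fuel k l Q : #|~: Q| < k -> #|~: Q| < l -> ter_nim_rec k Q = ter_nim_rec l Q.
  elim: k l Q => [|k IHk] [|l] Q //= ltk ltl; congr (mex _).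
  apply/eq_in_map => R; rewrite mem_enum => /ter_options_card ltR.
  by apply: IHk; apply: leq_trans ltR _.
rewrite {1}/ter_nim /=; congr (mex _); apply/eq_in_map => Q.
by rewrite mem_enum => /ter_options_card ltQ; apply: fuel.
Qed.

(* The nim-value of a game is that of its starting position. *)
Definition nim_TER : nat := ter_nim set0.

End TER.

Definition hypercube (n : nat) : rel (n.-tuple bool) :=
  [rel x y | #|[set i : 'I_n | tnth x i != tnth y i]| == 1].
Arguments hypercube n : clear implicits.

(* Main.v *)
Require Import Defs.
From mathcomp Require Import all_boot.
Set Implicit Arguments.
Unset Strict Implicit.
Unset Printing Implicit Defensive.

(* The second player wins by mirroring in the involution that flips one fixed *)
(* coordinate i. Convex sets of the cube being subcubes, the remaining set S  *)
(* generates the cube only if it meets every half-cube. If moreover S is      *)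
(* stable under the flip, then removing v from S cannot end the game: some y  *)
(* in S other than v lies on the same side of i as v (otherwise S would be    *)
(* an edge), and v is on a geodesic from its mirror image to y. Hence the     *)
(* first player never makes the last move.                                    *)

(** A position has nim-value zero exactly when the player to move loses, so it suffices to answer
    every move. [ter_nim_mirror] isolates the game-theoretic part; its condition on generating sets
    is checked for a coordinate flip in [hull_flip_stableD1], from two facts on geodesics,
    [convex_halfcube] and [convex_flip_mem]. *)

Lemma mex_eq0 (s : seq nat) : (mex s == 0) = (0 \notin s).
Proof.
rewrite /mex; case: ex_minnP => m ms minm.
by apply/eqP/idP => [<- // | /minm]; rewrite leqn0 => /eqP.
Qed.

Section Mirroring.

Variables (V : finType) (e : rel V).

Lemma ter_nim_eq0 (P : {set V}) :
  (ter_nim e P == 0) = [forall Q in ter_options e P, ter_nim e Q != 0].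
Proof.
rewrite ter_nimE mex_eq0; apply/idP/forall_inP => [N0 Q optQ | allQ].
  apply: contra N0 => /eqP <-; apply/mapP; exists Q => //.
  by rewrite mem_enum.
apply/negP=> /mapP[Q]; rewrite mem_enum => /allQ Q0 Q_0.
by rewrite -Q_0 in Q0.
Qed.

(** Induction on the number of remaining vertices: a move [v] from a stable position is answered by
    [f v], which restores stability. *)
Lemma ter_nim_mirror (f : V -> V) :
    involutive f -> (forall x, f x != x) ->
    (forall (S : {set V}) v, f @^-1: S = S -> hull e S = [set: V] -> v \in S ->
       hull e (S :\ v) = [set: V]) ->
  forall P : {set V}, f @^-1: P = P -> ter_nim e P = 0.
Proof.
move=> fK f_neq hullD1 P.
have [m] := ubnP #|~: P|; elim: m P => // m IHm P ltPm fP.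
apply/eqP; rewrite ter_nim_eq0; apply/forall_inP=> Q optQ.
have ltQ := ter_options_card optQ.
move: optQ; rewrite {1}/ter_options; case: ifP => [/eqP hullP|_]; last first.
  by rewrite inE.
case/imsetP=> v vP defQ; rewrite ter_nim_eq0; apply/forall_inPn.
have hullQ : hull e (~: Q) = [set: V].
  rewrite defQ setCU setIC -setDE; apply: hullD1 => //.
  by rewrite preimsetC fP.
(* The answer is still free: [f v] differs from [v], and it lies outside the stable set [P] because
   [v] does. *)
have optR : (f v |: Q) \in ter_options e Q.
  rewrite /ter_options hullQ eqxx; apply: imset_f.
  by move: vP; rewrite defQ !inE negb_or f_neq -{1}fP inE.
exists (f v |: Q); rewrite ?negbK //; apply/eqP/IHm.
  exact: leq_trans (ter_options_card optR) (ltnW (leq_trans ltQ ltPm)).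
apply/setP=> x; rewrite defQ !inE (can_eq fK) (inv_eq fK) -[in RHS]fP inE.
by rewrite !orbA [(x == v) || _]orbC.
Qed.

End Mirroring.

Section Cube.

Variable n : nat.
Implicit Types (x y z : n.-tuple bool) (i j : 'I_n).

Definition diffset x y : {set 'I_n} := [set i | tnth x i != tnth y i].

Lemma diffset_eq0 x y : (diffset x y == set0) = (x == y).
Proof.
apply/eqP/eqP => [/setP D0 | ->]; last by apply/setP=> i; rewrite !inE eqxx.
by apply: eq_from_tnth => i; move: (D0 i); rewrite !inE => /negbFE/eqP.
Qed.

Lemma diffset_sub x y z : diffset x z \subset diffset x y :|: diffset y z.
Proof.
apply/subsetP=> i; rewrite !inE -negb_and; apply: contra.
by case/andP=> /eqP-> /eqP->.
Qed.

Lemma hypercubeE x y : hypercube n x y = (#|diffset x y| == 1).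
Proof. by []. Qed.

(** Each edge changes one coordinate. With [walk_diffset], this makes graph distance the Hamming
    distance. *)
Lemma walk_size x y p :
  walk (hypercube n) x y p -> #|diffset x y| <= size p.
Proof.
case/andP; elim: p x => [|z p IHp] x /=.
  by move=> _; rewrite -diffset_eq0 => /eqP->; rewrite cards0.
case/andP; rewrite hypercubeE => /eqP xz pz /(IHp _ pz) zy.
apply: leq_trans (subset_leq_card (diffset_sub x z y)) _.
by apply: leq_trans (leq_card_setU _ _) _; rewrite xz.
Qed.

Definition flip i x : n.-tuple bool := [tuple tnth x j (+) (j == i) | j < n].

Lemma tnth_flip i x j : tnth (flip i x) j = tnth x j (+) (j == i).
Proof. by rewrite tnth_mktuple. Qed.

Lemma flipK i : involutive (flip i).
Proof. by move=> x; apply: eq_from_tnth => j; rewrite !tnth_flip addbK. Qed.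

Lemma diffset_flip i x : diffset x (flip i x) = [set i].
Proof.
by apply/setP=> j; rewrite !inE tnth_flip; case: (tnth x j); case: (j == i).
Qed.

Lemma hypercube_flip i x : hypercube n x (flip i x).
Proof. by rewrite hypercubeE diffset_flip cards1. Qed.

Lemma flip_neq i x : flip i x != x.
Proof. by rewrite eq_sym -diffset_eq0 diffset_flip -card_gt0 cards1. Qed.

Lemma diffset_flipl i x y :
  i \in diffset x y -> diffset (flip i x) y = diffset x y :\ i.
Proof.
rewrite inE => xyi; apply/setP=> j; rewrite !inE tnth_flip.
have [->|_] /= := eqVneq j i; last by rewrite addbF.
by move: xyi; case: (tnth x i) (tnth y i) => [] [].
Qed.

Lemma walk_diffset x y :
  exists2 p, walk (hypercube n) x y p & size p = #|diffset x y|.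
Proof.
move Dm: #|diffset x y| => m; elim: m x Dm => [|m IHm] x Dm.
  exists [::] => //; rewrite /walk /= -diffset_eq0.
  by rewrite -cards_eq0 Dm.
have /card_gt0P[i xyi] : 0 < #|diffset x y| by rewrite Dm.
have [|p /andP[ep lp] sp] := IHm (flip i x).
  by apply/eqP; rewrite -eqSS -Dm (cardsD1 i (diffset x y)) xyi diffset_flipl.
by exists (flip i x :: p); rewrite /= ?sp // /walk /= hypercube_flip ep.
Qed.

(** A walk that visits [z] outside the half-cube changes coordinate [i], on which its ends agree,
    besides all those on which they differ; so it is not shortest. *)
Lemma convex_halfcube i b : convex (hypercube n) [set x | tnth x i == b].
Proof.
apply/convexP=> x y p z; rewrite !inE => /eqP xi /eqP yi.
case/shortest_pathP=> wp minp.
case/predU1P=> [->|zp]; first exact/eqP.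
move: wp minp; case/splitPr: zp => p1 p2 wp minp.
apply/negPn/negP=> zi.
have [q /minp le_q sq] := walk_diffset x y.
have /andP[w1 w2] : walk (hypercube n) x z (rcons p1 z) && walk (hypercube n) z y p2.
  move: wp; rewrite /walk cat_path last_cat rcons_path last_rcons eqxx andbT /=.
  by case/andP=> /and3P[-> -> ->] ->.
have le1 := walk_size w1; have le2 := walk_size w2.
have : #|diffset x y| < #|diffset x z :|: diffset z y|.
  apply: proper_card; apply/properP; split; first exact: diffset_sub.
  by exists i; rewrite !inE xi yi ?eqxx // zi orbT.
rewrite ltnNge => /negP[]; rewrite -sq.
apply: leq_trans (leq_card_setU _ _) (leq_trans (leq_add le1 le2) _).
by apply: leq_trans le_q; rewrite size_rcons size_cat /= addSnnS.
Qed.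

(** Since [x] and [y] agree at [i], [flip i x] is one step farther from [y] than [x] is, so some
    geodesic from it to [y] starts through [x]. *)
Lemma convex_flip_mem (K : {set n.-tuple bool}) i x y :
    convex (hypercube n) K -> flip i x \in K -> y \in K ->
  tnth y i = tnth x i -> x \in K.
Proof.
move=> /convexP cK fxK yK yxi.
have [p /andP[ep lp] sp] := walk_diffset x y.
apply: (cK _ y (x :: p) _ fxK yK); last by rewrite !inE eqxx orbT.
apply/shortest_pathP; split=> [|q /walk_size].
  by rewrite /walk /= -[X in hypercube n _ X](flipK i) hypercube_flip ep.
have -> : diffset (flip i x) y = i |: diffset x y.
  apply/setP=> j; rewrite !inE tnth_flip; have [->|_] /= := eqVneq j i.
    by rewrite yxi; case: (tnth x i).
  by rewrite addbF.
by rewrite cardsU1 inE yxi eqxx /= sp.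
Qed.

Lemma hull_flip_stableD1 i j (S : {set n.-tuple bool}) v :
    i != j -> flip i @^-1: S = S -> hull (hypercube n) S = [set: n.-tuple bool] ->
  v \in S -> hull (hypercube n) (S :\ v) = [set: n.-tuple bool].
Proof.
move=> neq_ij fS hullS vS.
have memf x : (flip i x \in S) = (x \in S) by rewrite -[in RHS]fS inE.
set H := hull _ _; have subH : S :\ v \subset H by apply: sub_hull.
suff vH : v \in H.
  apply/eqP; rewrite -subTset -hullS; apply: hull_min (convex_hull _ _) _.
  by rewrite -{1}(setD1K vS) subUset sub1set vH.
have [y /andP[/andP[yv yS] /eqP yvi] | onlyv] :=
    pickP [pred y | (y != v) && (y \in S) && (tnth y i == tnth v i)].
  apply: (convex_flip_mem (convex_hull _ _)) yvi.
    by apply: (subsetP subH); rewrite !inE flip_neq memf.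
  by apply: (subsetP subH); rewrite !inE yv.
(* Otherwise stability confines [S] to the edge from [v] to [flip i v]. Coordinate [j] is constant
   there, so [S] lies in a half-cube and cannot generate. *)
have Sedge x : x \in S -> tnth x i = tnth v i -> x = v.
  by move=> xS xvi; move: (onlyv x); rewrite /= xS xvi eqxx !andbT => /negbFE/eqP.
have subS : S \subset [set x | tnth x j == tnth v j].
  apply/subsetP=> x xS; rewrite inE.
  have [/(Sedge _ xS)-> //|/eqP xvi] := eqVneq (tnth x i) (tnth v i).
  rewrite -(Sedge (flip i x)) ?memf // tnth_flip ?[j == i]eq_sym.
    by rewrite (negbTE neq_ij) addbF.
  by rewrite eqxx; case: (tnth x i) (tnth v i) xvi => [] [].
have /subsetP/(_ (flip j v)) := hull_min (convex_halfcube j (tnth v j)) subS.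
by rewrite hullS !inE tnth_flip eqxx => /(_ isT); case: (tnth v j).
Qed.

End Cube.

Theorem proposition5p7 (n : nat) (hn : 3 <= n) : nim_TER (hypercube n) = 0.
Proof.
have n_gt1 := ltnW hn.
(* The mirror flips coordinate 0; coordinate 1 serves as the second direction [j]. *)
pose i : 'I_n := Ordinal (ltnW n_gt1); pose j : 'I_n := Ordinal n_gt1.
apply: (ter_nim_mirror (flipK i) (flip_neq i)); last exact: preimset0.
by move=> S v; apply: (@hull_flip_stableD1 _ i j).
Qed.
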